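(* For all rational numbers $m,t$, define $$\begin{aligned} x_1&=2m^2-6t(t-2)m+6(t-1)(t+2)(3t-2),\\ x_2&=m^2t+16(t-1)m-3t(t+2)(3t-2),\\ x_3&=(2t-2)m^2-2(3t^2-4t+4)m-6(t+2)(3t-2),\\ y_1&=(2t-2)m^2-6t(t-2)m+6(t+2)(3t-2),\\ y_2&=m^2t-16(t-1)m-3t(t+2)(3t-2),\\ y_3&=2m^2+2(3t^2-4t+4)m-6(t-1)(t+2)(3t-2), \end{aligned}$$ and $x_4=-x_3$, $x_5=-x_2$, $x_6=-x_1$, $y_4=-y_3$, $y_5=-y_2$, $y_6=-y_1$. Then $$\sum_{i=1}^6x_i^r=\sum_{i=1}^6y_i^r\qquad\text{for } r=1,2,3,4,5.$$ Moreover, as a parametric solution this is nontrivial: in $\mathbb{Q}[m,t]$ the multisets $\{x_1,\dots,x_6\}$ and $\{y_1,\dots,y_6\}$ are distinct.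
   Context: An ideal solution of the Tarry-Escott problem of degree $k$ consists of two distinct multisets $\{x_1,\dots,x_{k+1}\}$, $\{y_1,\dots,y_{k+1}\}$ with $\sum x_i^r=\sum y_i^r$ for $r=1,\dots,k$. *)

(* Defs.v *)
From mathcomp Require Import all_boot all_algebra.
From mathcomp Require Import mpoly.
Set Implicit Arguments.
Unset Strict Implicit.
Unset Printing Implicit Defensive.
Import GRing.Theory.
Local Open Scope ring_scope.

(* The formulas are stated over an arbitrary commutative ring so that the same
   expressions can be evaluated at rational numbers and at the indeterminates
   of Q[m,t]. *)
Definition x1 (R : comNzRingType) (m t : R) : R :=
  2 * m ^+ 2 - 6 * t * (t - 2) * m + 6 * (t - 1) * (t + 2) * (3 * t - 2).
Definition x2 (R : comNzRingType) (m t : R) : R :=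
  m ^+ 2 * t + 16 * (t - 1) * m - 3 * t * (t + 2) * (3 * t - 2).
Definition x3 (R : comNzRingType) (m t : R) : R :=
  (2 * t - 2) * m ^+ 2 - 2 * (3 * t ^+ 2 - 4 * t + 4) * m
  - 6 * (t + 2) * (3 * t - 2).

Definition y1 (R : comNzRingType) (m t : R) : R :=
  (2 * t - 2) * m ^+ 2 - 6 * t * (t - 2) * m + 6 * (t + 2) * (3 * t - 2).
Definition y2 (R : comNzRingType) (m t : R) : R :=
  m ^+ 2 * t - 16 * (t - 1) * m - 3 * t * (t + 2) * (3 * t - 2).
Definition y3 (R : comNzRingType) (m t : R) : R :=
  2 * m ^+ 2 + 2 * (3 * t ^+ 2 - 4 * t + 4) * m
  - 6 * (t - 1) * (t + 2) * (3 * t - 2).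

(* Multisets are represented by sequences, compared up to [perm_eq]. *)
Definition xs (R : comNzRingType) (m t : R) : seq R :=
  [:: x1 m t; x2 m t; x3 m t; - x3 m t; - x2 m t; - x1 m t].
Definition ys (R : comNzRingType) (m t : R) : seq R :=
  [:: y1 m t; y2 m t; y3 m t; - y3 m t; - y2 m t; - y1 m t].

Definition m_var : {mpoly rat[2]} := 'X_ord0.
Definition t_var : {mpoly rat[2]} := 'X_ord_max.

(* Main.v *)
Require Import Defs.
From mathcomp Require Import all_boot all_algebra.
From mathcomp Require Import mpoly.
From mathcomp Require Import ring.
Import GRing.Theory.
Local Open Scope ring_scope.

(* Both multisets are symmetric under negation, so odd power sums vanish and
   only the exponents 2 and 4 need a polynomial identity. Distinctness of the
   two multisets of polynomials is witnessed by the specialization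
   (m, t) = (1, -1), where the absolute values are {44, 48, 4} and
   {52, 16, 36}. *)

(** Pairing [z] with [- z] pulls out a sign factor that is 0 for odd [r] and 2 for even [r]. *)
Lemma sum_sym6 (R : comNzRingType) (a b c : R) (r : nat) :
  \sum_(z <- [:: a; b; c; - c; - b; - a]) z ^+ r
    = (1 + (-1) ^+ r) * (a ^+ r + b ^+ r + c ^+ r).
Proof.
rewrite !(big_cons, big_nil) (exprNn a) (exprNn b) (exprNn c); ring.
Qed.

Lemma x_y_sum_sqr (R : comNzRingType) (m t : R) :
  x1 m t ^+ 2 + x2 m t ^+ 2 + x3 m t ^+ 2
    = y1 m t ^+ 2 + y2 m t ^+ 2 + y3 m t ^+ 2.
Proof. by rewrite /x1 /x2 /x3 /y1 /y2 /y3; ring. Qed.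

Lemma x_y_sum_exp4 (R : comNzRingType) (m t : R) :
  x1 m t ^+ 4 + x2 m t ^+ 4 + x3 m t ^+ 4
    = y1 m t ^+ 4 + y2 m t ^+ 4 + y3 m t ^+ 4.
Proof. by rewrite /x1 /x2 /x3 /y1 /y2 /y3; ring. Qed.

Lemma sum_xs_ys (R : comNzRingType) (m t : R) (r : nat) : (1 <= r <= 5)%N ->
  \sum_(z <- xs m t) z ^+ r = \sum_(z <- ys m t) z ^+ r.
Proof.
(* With the sign depending only on [odd r], the factor reduces to [1 - 1] at 1, 3, 5; only 2 and 4
   remain. *)
rewrite /xs /ys !sum_sym6 -signr_odd.
case: r => [|[|[|[|[|[|r]]]]]] //= _; rewrite ?subrr ?mul0r //.
  by rewrite x_y_sum_sqr.
by rewrite x_y_sum_exp4.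
Qed.

(** The entries are polynomials in [m], [t] with integer coefficients, hence commute with any ring
    morphism. *)
Lemma rmorph_xs (R S : comNzRingType) (f : {rmorphism R -> S}) (m t : R) :
  [seq f z | z <- xs m t] = xs (f m) (f t).
Proof.
by rewrite /xs /x1 /x2 /x3 /= !(rmorphN, rmorphB, rmorphD, rmorphM, rmorphXn,
  rmorph_nat, rmorph1).
Qed.

Lemma rmorph_ys (R S : comNzRingType) (f : {rmorphism R -> S}) (m t : R) :
  [seq f z | z <- ys m t] = ys (f m) (f t).
Proof.
by rewrite /ys /y1 /y2 /y3 /= !(rmorphN, rmorphB, rmorphD, rmorphM, rmorphXn,
  rmorph_nat, rmorph1).
Qed.

(** By contraposition, inequality at one rational point gives inequality over Q[m,t]. *)
Lemma rmorph_perm_xs_ys (R S : comNzRingType) (f : {rmorphism R -> S})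
    (m t : R) :
  perm_eq (xs m t) (ys m t) -> perm_eq (xs (f m) (f t)) (ys (f m) (f t)).
Proof. by move/(perm_map f); rewrite rmorph_xs rmorph_ys. Qed.

Lemma xs_ys_1_N1_neq : ~~ perm_eq (xs (1 : rat) (-1)) (ys (1 : rat) (-1)).
Proof. by vm_compute. Qed.

Theorem mainTheorem4 :
  (forall (m t : rat) (r : nat), (1 <= r <= 5)%N ->
     \sum_(z <- xs m t) z ^+ r = \sum_(z <- ys m t) z ^+ r)
  /\ ~~ perm_eq (xs m_var t_var) (ys m_var t_var).
Proof.
split=> [m t r|]; first exact: sum_xs_ys.
have X_at (v : 'I_2 -> rat) : perm_eq (xs m_var t_var) (ys m_var t_var) ->
    perm_eq (xs (v ord0) (v ord_max)) (ys (v ord0) (v ord_max)).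
  by move/(rmorph_perm_xs_ys _ _ (meval v)); rewrite /= !mevalXU.
(* Index [ord0] carries [m] and [ord_max] carries [t], so this valuation is the point (1, -1). *)
apply/negP => /(X_at (fun i => if i == ord0 then 1 else -1)) /=.
exact/negP/xs_ys_1_N1_neq.
Qed.
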